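(* Let $P=(X,\prec)$ be a finite poset of width two with $n=|X|$ elements, let $X=\mathcal{C}_1\sqcup\mathcal{C}_2$ be a fixed partition into two chains $\mathcal{C}_1=\{\alpha_1\prec\cdots\prec\alpha_{a}\}$ and $\mathcal{C}_2=\{\beta_1\prec\cdots\prec\beta_{b}\}$, and let $x\in X$. For an integer $k$ define $$N_q(k)\;:=\;\sum_{L\in\mathcal{E}(P)\,:\,L(x)=k} q^{\mathrm{wgt}(L)}\in\mathbb{Z}[q].$$ Then $$N_q(k)^2\;\geqslant\;N_q(k-1)\,N_q(k+1)\qquad\text{for all } k>1,$$ where the inequality between polynomials in $q$ is coefficient-wise, i.e. $N_q(k)^2-N_q(k-1)N_q(k+1)$ has nonnegative coefficients.
   Context: A linear extension of $P$ is a bijection $L:X\to\{1,\dots,n\}$ such that $L(u)<L(v)$ whenever $u\prec v$; $\mathcal{E}(P)$ denotes the set of linear extensions. The weight of $L$ (depending on the chain partition) is $\mathrm{wgt}(L):=\sum_{i=1}^{a}L(\alpha_i)$. An empty sum is $0$. *)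

(* Defs.v *)
From mathcomp Require Import all_boot all_order all_algebra.

Set Implicit Arguments.
Unset Strict Implicit.
Unset Printing Implicit Defensive.

Import Order.TTheory GRing.Theory Num.Theory.

Local Open Scope ring_scope.

Definition antichain (d : Order.disp_t) (X : finPOrderType d) (A : {set X}) : bool :=
  [forall u in A, forall v in A, (u != v) ==> (u >< v)%O].

Definition width (d : Order.disp_t) (X : finPOrderType d) : nat :=
  (\max_(A : {set X} | antichain A) #|A|)%N.

Definition chain_enum (d : Order.disp_t) (X : finPOrderType d) (m : nat)
    (c : 'I_m -> X) : Prop :=
  forall i j : 'I_m, (i < j)%N -> (c i < c j)%O.

Definition chain_partition (d : Order.disp_t) (X : finPOrderType d) (a b : nat)
    (alpha : 'I_a -> X) (beta : 'I_b -> X) : Prop :=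
  let C1 := [set alpha i | i : 'I_a] in
  let C2 := [set beta j | j : 'I_b] in
  [/\ chain_enum alpha, chain_enum beta,
      [disjoint C1 & C2] & C1 :|: C2 = [set: X]].

(* The codomain {0, ..., n} is cut down to {1, ..., n} by the image condition. *)
Definition linear_extension (d : Order.disp_t) (X : finPOrderType d)
    (L : {ffun X -> 'I_#|X|.+1}) : bool :=
  [&& injectiveb L,
      [set L u | u : X] == [set i : 'I_#|X|.+1 | (0 < i)%N]
    & [forall u : X, forall v : X, (u < v)%O ==> (L u < L v)%N]].

Definition wgt (d : Order.disp_t) (X : finPOrderType d) (a : nat)
    (alpha : 'I_a -> X) (L : {ffun X -> 'I_#|X|.+1}) : nat :=
  (\sum_(i < a) L (alpha i))%N.

Definition Nq (d : Order.disp_t) (X : finPOrderType d) (a : nat)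
    (alpha : 'I_a -> X) (x : X) (k : int) : {poly int} :=
  \sum_(L : {ffun X -> 'I_#|X|.+1} | linear_extension L && ((L x)%:Z == k))
    'X^(wgt alpha L).

(* Main.v *)
Require Import Defs.
From mathcomp Require Import all_boot all_order all_algebra.
From mathcomp Require Import zify ring.

Set Implicit Arguments.
Unset Strict Implicit.
Unset Printing Implicit Defensive.

Import Order.TTheory GRing.Theory Num.Theory.

Local Open Scope ring_scope.

(* A linear extension L is determined by the heights h_i = #{j | L (beta_j) <
   L (alpha_i)}: these form a nondecreasing sequence in which each h_i is
   confined to an interval, and L (alpha_i) = i + h_i, so that wgt L is a
   constant plus the sum of the h_i.  For x = alpha_r, N_q(k) is thus, up to a
   power of q, the marginal at coordinate r of the product weight
   \prod_i [h_i is allowed] q^(h_i) on nondecreasing sequences.  Each factor is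
   log-concave for the coefficientwise order, and log-concavity is preserved by
   products, prefix sums and suffix sums, which is all it takes to sum out the
   other coordinates.  For x = beta_r, exchange the chains: wgt relative to
   alpha and to beta add up to a constant, so the coefficients get reversed. *)

(** * Log-concave sequences with respect to a semiring [S] *)

Section LogConcave.
Variables (R : comNzRingType) (S : semiringClosed R).
Implicit Types f g : nat -> R.

(* The inequality between adjacent terms alone would not suffice, since S is not
   assumed to allow division. *)
Definition log_concave f : Prop :=
  (forall i, f i \in S) /\
  forall i j k, f (i + j)%N * f (i + k)%N - f i * f (i + j + k)%N \in S.

Lemma eq_log_concave f g : f =1 g -> log_concave f -> log_concave g.
Proof. by move=> e [f0 fc]; split=> [i|i j k]; rewrite -!e. Qed.

Lemma log_concaveM f g :
  log_concave f -> log_concave g -> log_concave (fun t => f t * g t).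
Proof.
move=> [f0 fc] [g0 gc]; split=> [i|i j k]; first exact: rpredM.
have -> : f (i + j)%N * g (i + j)%N * (f (i + k)%N * g (i + k)%N)
   - f i * g i * (f (i + j + k)%N * g (i + j + k)%N)
  = (f (i + j)%N * f (i + k)%N - f i * f (i + j + k)%N)
      * (g (i + j)%N * g (i + k)%N)
  + f i * f (i + j + k)%N
      * (g (i + j)%N * g (i + k)%N - g i * g (i + j + k)%N) by ring.
by rewrite rpredD // !rpredM.
Qed.

Lemma log_concave_const c : c \in S -> log_concave (fun=> c).
Proof. by move=> Sc; split=> // i j k; rewrite subrr rpred0. Qed.

Lemma log_concave_exp q : q \in S -> log_concave (fun t => q ^+ t).
Proof.
move=> Sq; split=> [i|i j k]; first exact: rpredX.
rewrite -!exprD (_ : (i + j + (i + k) = i + (i + j + k))%N); last by lia.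
by rewrite subrr rpred0.
Qed.

(** Both [i + j] and [i + k] lie between [i] and [i + j + k], so when the subtracted product is 1
    the other one is 1 as well. *)
Lemma log_concave_indicator (c : pred nat) :
  (forall i j k, c i -> c k -> (i <= j <= k)%N -> c j) ->
  log_concave (fun t => (c t)%:R).
Proof.
move=> conv; split=> [i|i j k]; first exact: rpred_nat.
have [ci|] := boolP (c i); last by rewrite mul0r subr0 rpredM ?rpred_nat.
have [ck|] := boolP (c (i + j + k)%N);
  last by rewrite mulr0 subr0 rpredM ?rpred_nat.
by rewrite !(conv _ _ _ ci ck) ?subrr ?rpred0 //; lia.
Qed.

(** After cancellation the difference is a sum over [i < u <= i + j] of
    [f u * F (i + k).+1 - F i.+1 * f (u + k)]. Keeping only the last [i.+1] terms of [F (i + k).+1]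
    and pairing them with those of [F i.+1] leaves [f u * f (v + k) - f v * f (u + k)] with
    [v <= i < u], which is log-concavity of [f] based at [v]. *)
Lemma log_concave_prefix f :
  log_concave f -> log_concave (fun t => \sum_(0 <= u < t.+1) f u).
Proof.
move=> [f0 fc]; have F0 m n : \sum_(m <= u < n) f u \in S by exact: rpred_sum.
split=> [//|i j k].
pose F t := \sum_(0 <= u < t) f u; rewrite -!/(F _).
have Fcat s t : (s <= t)%N -> F t = F s + \sum_(s <= u < t) f u.
  by move=> le_st; rewrite /F (big_cat_nat _ (n := s)).
have shift : \sum_((i + k).+1 <= u < (i + j + k).+1) f u
  = \sum_(i.+1 <= u < (i + j).+1) f (u + k)%N.
  by rewrite -(addSn i k) -(addSn (i + j)%N k) big_addn addnK.
rewrite (Fcat (i + k).+1 (i + j + k).+1) ?shift; last by lia.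
rewrite (Fcat i.+1 (i + j).+1); last by lia.
set D := \sum_(i.+1 <= u < _) f u; set D' := \sum_(_ <= u < _) _.
have -> : (F i.+1 + D) * F (i + k).+1 - F i.+1 * (F (i + k).+1 + D')
  = D * F (i + k).+1 - F i.+1 * D' by ring.
rewrite mulr_suml mulr_sumr -sumrB big_nat; apply: rpred_sum => u /andP[iu uj].
(* The first [k] terms of [F (i + k).+1] only contribute an element of [S]. *)
rewrite (Fcat k (i + k).+1) ?(leqW (leq_addl _ _)) // mulrDr.
have -> : \sum_(k <= v < (i + k).+1) f v = \sum_(0 <= v < i.+1) f (v + k)%N.
  by rewrite -{1}(add0n k) big_addn -addSn addnK.
rewrite -addrA rpredD ?rpredM ?f0 ?F0 // mulr_sumr mulr_suml -sumrB big_nat.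
apply: rpred_sum => v /andP[_ vi].
by have := fc v (u - v)%N k; rewrite !subnKC //; lia.
Qed.

(** The pairing is that of prefix sums, mirrored: the differences are
    [f (u + k) * f v - f u * f (v + k)] with [u < i + j <= v < n - k], and the terms of [G (i + j)]
    from [n - k] on are left over. *)
Lemma log_concave_suffix f n :
  log_concave f -> log_concave (fun t => \sum_(t <= u < n) f u).
Proof.
move=> [f0 fc]; have F0 s t : \sum_(s <= u < t) f u \in S by exact: rpred_sum.
split=> [//|i j k].
have [le_n|lt_n] := leqP n (i + j + k).
  by rewrite [X in _ - _ * X](big_geq le_n) mulr0 subr0 rpredM.
pose G t := \sum_(t <= u < n) f u; rewrite -!/(G _).
have Gcat s t : (s <= t <= n)%N -> G s = \sum_(s <= u < t) f u + G t.
  by case/andP=> st tn; rewrite /G (big_cat_nat _ (n := t)).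
have shift : \sum_(i + k <= u < i + j + k) f u
  = \sum_(i <= u < i + j) f (u + k)%N by rewrite big_addn addnK.
rewrite (Gcat (i + k)%N (i + j + k)%N) ?shift; last by lia.
rewrite (Gcat i (i + j)%N); last by lia.
set D := \sum_(i <= u < _) f u; set D' := \sum_(_ <= u < _) _.
have -> : G (i + j)%N * (D' + G (i + j + k)%N)
    - (D + G (i + j)%N) * G (i + j + k)%N
  = D' * G (i + j)%N - D * G (i + j + k)%N by ring.
rewrite mulr_suml mulr_suml -sumrB big_nat; apply: rpred_sum => u /andP[iu uj].
have -> : G (i + j + k)%N = \sum_(i + j <= v < n - k) f (v + k)%N.
  by rewrite /G big_addn.
rewrite /G (big_cat_nat _ (n := (n - k)%N)) ?leq_subr //=; last by lia.
rewrite mulrDr addrAC rpredD ?rpredM // !mulr_sumr -sumrB big_nat.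
apply: rpred_sum => v /andP[ijv _].
have := fc u k (v - u)%N; rewrite subnKC ?(leq_trans (ltnW uj)) //.
by rewrite -addnA [(k + _)%N]addnC addnA subnKC // ?(leq_trans (ltnW uj)).
Qed.

(** * Sums of product weights over nondecreasing sequences *)

Section MonotoneSums.
Variable n : nat.

Definition monotone a (h : {ffun 'I_a -> 'I_n}) : bool :=
  [forall i : 'I_a, forall j : 'I_a, (i <= j)%N ==> (h i <= h j)%N].

(** The lower bound [t] makes the sum recursive: once the first coordinate is fixed, its value is
    the bound for the others. *)
Definition monotone_sum a (f : 'I_a -> nat -> R) (t : nat) : R :=
  \sum_(h : {ffun 'I_a -> 'I_n} | monotone h && [forall i, (t <= h i)%N])
     \prod_i f i (h i).

Lemma eq_monotone_sum a (f g : 'I_a -> nat -> R) t :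
  (forall i (j : 'I_n), f i j = g i j) -> monotone_sum f t = monotone_sum g t.
Proof. by move=> e; apply: eq_bigr => h _; apply: eq_bigr. Qed.

Lemma monotone_sum0 (f : 'I_0 -> nat -> R) t : monotone_sum f t = 1.
Proof.
rewrite /monotone_sum (eq_bigl xpredT) => [|h].
  rewrite (eq_bigr (fun=> 1)) => [|h _]; last by rewrite big_ord0.
  by rewrite sumr_const card_ffun !card_ord expn0.
by rewrite andbC; apply/andP; split; apply/forallP=> -[].
Qed.

Lemma monotone_sumS a (f : 'I_a.+1 -> nat -> R) t :
  monotone_sum f t =
  \sum_(j < n | (t <= j)%N)
     f ord0 j * monotone_sum (fun i => f (lift ord0 i)) j.
Proof.
(* [mk] prepends a first value to a sequence and [un] splits it off. *)
pose mk (p : 'I_n * {ffun 'I_a -> 'I_n}) : {ffun 'I_a.+1 -> 'I_n} :=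
  [ffun i => if unlift ord0 i is Some i' then p.2 i' else p.1].
pose un (h : {ffun 'I_a.+1 -> 'I_n}) := (h ord0, [ffun i => h (lift ord0 i)]).
have mk0 p : mk p ord0 = p.1 by rewrite ffunE unlift_none.
have mkS p i : mk p (lift ord0 i) = p.2 i by rewrite ffunE liftK.
have mkK : cancel mk un.
  move=> [j h]; rewrite /un mk0; congr pair.
  by apply/ffunP => i; rewrite ffunE mkS.
have unK : cancel un mk.
  move=> h; apply/ffunP => i.
  by case: (unliftP ord0 i) => [i'|] ->; rewrite ?mk0 ?mkS ?ffunE.
rewrite /monotone_sum (reindex mk); last by exists un => ? _.
under [RHS]eq_bigr do rewrite mulr_sumr.
rewrite (pair_big_dep (fun j : 'I_n => (t <= j)%N)).
apply: eq_big => [[j h]|[j h] _] /=; last first.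
  rewrite big_ord_recl mk0; congr (_ * _).
  by apply: eq_bigr => i _; rewrite mkS.
apply/andP/and3P => [[/forallP m /forallP t0]|[tj /forallP m /forallP jh]].
  split.
  - by have := t0 ord0; rewrite mk0.
  - apply/forallP=> i; apply/forallP=> i'; apply/implyP=> le_i.
    have /forallP/(_ (lift ord0 i'))/implyP := m (lift ord0 i).
    by rewrite !mkS; apply.
  - apply/forallP=> i.
    by have /forallP/(_ (lift ord0 i))/implyP := m ord0; rewrite mk0 mkS; apply.
split; apply/forallP=> i; last first.
  case: (unliftP ord0 i) => [i'|] ->; rewrite ?mk0 ?mkS //.
  exact: leq_trans tj (jh _).
apply/forallP=> i'; apply/implyP.
case: (unliftP ord0 i) => [i1|] ->; case: (unliftP ord0 i') => [i2|] ->;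
  rewrite ?mk0 ?mkS //.
by move=> le_i; have /forallP/(_ i2)/implyP := m i1; apply.
Qed.

Lemma log_concave_monotone_sum a (f : 'I_a -> nat -> R) :
  (forall i, log_concave (f i)) -> log_concave (monotone_sum f).
Proof.
elim: a f => [|a IH] f lcf.
  apply: (eq_log_concave (f := fun=> 1)) => [t|]; first by rewrite monotone_sum0.
  by apply/log_concave_const/rpred1.
pose g := fun t => f ord0 t * monotone_sum (fun i => f (lift ord0 i)) t.
apply: (eq_log_concave (f := fun t => \sum_(t <= u < n) g u)) => [t|].
  by rewrite monotone_sumS big_geq_mkord.
by apply/log_concave_suffix/log_concaveM; [|apply: IH => i].
Qed.

(* Summing out the first coordinate multiplies the weight of the second one by
   a prefix sum. *)
Lemma monotone_sum_fuse a (f : 'I_a.+2 -> nat -> R) :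
  monotone_sum f 0 =
  monotone_sum (fun i t =>
    (if i == ord0 then \sum_(0 <= u < t.+1) f ord0 u else 1)
    * f (lift ord0 i) t) 0.
Proof.
rewrite monotone_sumS [RHS]monotone_sumS.
under eq_bigr do rewrite monotone_sumS mulr_sumr.
rewrite (exchange_big_dep predT) //=; apply: eq_bigr => j _.
rewrite -big_distrl /= mulrA; congr (_ * _ * _); last first.
  by apply: eq_monotone_sum => i u; rewrite mul1r.
under eq_bigl do rewrite -ltnS.
by rewrite big_mkord (big_ord_narrow (ltn_ord j)).
Qed.

(** The constraint that coordinate [r] equals [t] is a factor of the weight, so a marginal is itself
    a [monotone_sum] and the lemmas above apply to it. *)
Definition marginal a (f : 'I_a -> nat -> R) (r : 'I_a) (t : nat) : R :=
  monotone_sum (fun i u => f i u * ((i == r) ==> (u == t))%:R) 0.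

Lemma log_concave_marginal0 a (f : 'I_a.+1 -> nat -> R) :
  (forall i, log_concave (f i)) -> log_concave (marginal f ord0).
Proof.
move=> lcf; pose G := monotone_sum (fun i => f (lift ord0 i)).
(* The indicator is needed because [G t] is 1 even for [t >= n] when no other coordinate is left. *)
apply: (eq_log_concave (f := fun t => (t < n)%N%:R * (f ord0 t * G t))).
  move=> t; rewrite /marginal monotone_sumS /=.
  have eG j : monotone_sum (fun i u =>
      f (lift ord0 i) u * ((lift ord0 i == ord0) ==> (u == t))%:R) j = G j.
    by apply: eq_monotone_sum => i u; rewrite mulr1.
  under eq_bigr do rewrite eG.
  have [lt_tn|le_nt] := ltnP t n.
    rewrite mul1r (bigD1 (Ordinal lt_tn)) //= eqxx mulr1 big1 ?addr0 // => j.
    by rewrite -val_eqE /= => /negPf ->; rewrite mulr0 mul0r.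
  rewrite mul0r big1 // => j _.
  by rewrite (ltn_eqF (leq_trans (ltn_ord j) le_nt)) mulr0 mul0r.
apply: log_concaveM; first by apply: log_concave_indicator => i j k; lia.
by apply: log_concaveM => //; apply: log_concave_monotone_sum.
Qed.

(** Coordinates before [r] are fused away one by one until [r] comes first. Each fusion multiplies a
    weight by a prefix sum and so keeps the weights log-concave. *)
Lemma log_concave_marginal a (f : 'I_a -> nat -> R) r :
  (forall i, log_concave (f i)) -> log_concave (marginal f r).
Proof.
case: a f r => [f [] //|]; elim=> [|a IH] f r lcf.
  by rewrite (ord1 r); apply: log_concave_marginal0.
case: (unliftP ord0 r) => [r'|] ->; last exact: log_concave_marginal0.
pose g (i : 'I_a.+1) t :=
  (if i == ord0 then \sum_(0 <= u < t.+1) f ord0 u else 1) * f (lift ord0 i) t.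
apply: (eq_log_concave (f := marginal g r')); last first.
  apply: IH => i; apply: log_concaveM => //.
  case: (i == ord0); first exact: log_concave_prefix.
  by apply/log_concave_const/rpred1.
move=> t; rewrite /marginal monotone_sum_fuse; apply: eq_monotone_sum => i u.
rewrite (inj_eq lift_inj) mulrA; congr (_ * _ * _).
by case: eqP => // _; apply: eq_bigr => v _; rewrite mulr1.
Qed.
End MonotoneSums.
End LogConcave.

(** * The coefficientwise order on integer polynomials *)

Definition nneg_int : semiringClosed int :=
  GRing.SemiringClosed.clone int (@Num.Def.nneg_num_pred int) _.

Definition nneg_poly : semiringClosed {poly int} :=
  GRing.SemiringClosed.clone {poly int} (polyOver_pred nneg_int) _.

Lemma nneg_polyP (p : {poly int}) :
  reflect (forall m, 0 <= p`_m) (p \in nneg_poly).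
Proof. exact: (iffP (@polyOverP _ nneg_int p)). Qed.

Lemma nneg_polyX : 'X \in nneg_poly.
Proof. exact: polyOverX. Qed.

Lemma card_ord_ltn m k : (k <= m)%N -> #|[set j : 'I_m | (j < k)%N]| = k.
Proof.
by move=> le_km; rewrite -sum1dep_card (big_ord_narrow le_km) sum1_card card_ord.
Qed.

(** A down-closed set of ordinals is an initial segment, hence determined by its size. This turns
    statements about counts into comparisons of individual elements. *)
Lemma card_downset m (A : {set 'I_m}) :
  (forall i j : 'I_m, (i <= j)%N -> j \in A -> i \in A) ->
  forall j : 'I_m, (j \in A) = (j < #|A|)%N.
Proof.
move=> down j; have [jA|jA] := boolP (j \in A); apply/esym.
  rewrite -[j.+1](@card_ord_ltn m) // subset_leq_card //.
  by apply/subsetP => i; rewrite inE ltnS => /down; apply.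
apply/negbTE; rewrite -leqNgt -[X in (_ <= X)%N](@card_ord_ltn m);
  last exact: ltnW.
apply/subset_leq_card/subsetP => i iA; rewrite inE ltnNge.
by apply: contra jA => /down; apply.
Qed.

Lemma sum_bool_card (T : finType) (P : pred T) :
  (\sum_u P u)%N = #|[set u | P u]|.
Proof.
by rewrite -sum1dep_card [RHS]big_mkcond; apply: eq_bigr => u _; case: (P u).
Qed.

(** * Linear extensions of a poset covered by two chains, and their heights *)

Section TwoChains.
Variables (d : Order.disp_t) (X : finPOrderType d) (a b : nat).
Variables (alpha : 'I_a -> X) (beta : 'I_b -> X).
Hypothesis hC : chain_partition alpha beta.
Local Notation labelling := {ffun X -> 'I_#|X|.+1}.
Local Notation heightfun := {ffun 'I_a -> 'I_b.+1}.
Implicit Types (L : labelling) (h : heightfun).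

Lemma chain_lt m (c : 'I_m -> X) : chain_enum c ->
  forall i j, (c i < c j)%O = (i < j)%N.
Proof.
move=> cc i j; have [lt_ij|lt_ji|/val_inj ->] := ltngtP i j.
- exact: cc.
- exact/lt_gtF/cc.
- exact: ltxx.
Qed.

Lemma chain_inj m (c : 'I_m -> X) : chain_enum c -> injective c.
Proof.
move=> cc i j e; apply: val_inj.
have := chain_lt cc i j; have := chain_lt cc j i.
by rewrite e ltxx; case: ltngtP.
Qed.

Lemma alpha_neq_beta i j : alpha i != beta j.
Proof.
case: hC => _ _ /disjointFr dis _; apply/eqP=> e.
by have := dis (alpha i); rewrite imset_f // e imset_f // => /(_ isT).
Qed.

Variant chain_spec : X -> Prop :=
  | InAlpha i : chain_spec (alpha i)
  | InBeta j : chain_spec (beta j).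

Lemma chainP u : chain_spec u.
Proof.
case: hC => _ _ _ /setP/(_ u); rewrite !inE.
by case/orP=> /imsetP[i _ ->]; constructor.
Qed.

Lemma big_chains (F : X -> nat) :
  (\sum_u F u = \sum_i F (alpha i) + \sum_j F (beta j))%N.
Proof.
case: hC => ca cb dis full.
rewrite -(big_imset _ (A := predT) (in2W (chain_inj ca))).
rewrite -(big_imset _ (A := predT) (in2W (chain_inj cb))).
rewrite -bigU //=; apply: eq_bigl => u.
by move/setP/(_ u): full; rewrite !inE.
Qed.

Lemma card_chains : #|X| = (a + b)%N.
Proof. by rewrite -sum1_card big_chains !sum1_card !card_ord. Qed.

Lemma card_labels : #|[set i : 'I_#|X|.+1 | (0 < i)%N]| = #|X|.
Proof.
rewrite -[RHS]/(#|X|.+1.-1) -[X in X.-1]card_ord -(cardsC1 ord0).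
by apply: eq_card => i; rewrite !inE -val_eqE /= lt0n.
Qed.

Lemma linear_extensionP L :
  reflect [/\ injective L, forall i : 'I_#|X|.+1, (0 < i)%N = (i \in L @: X)
            & forall u v, (u < v)%O -> (L u < L v)%N] (linear_extension L).
Proof.
apply: (iffP and3P) => -[].
  move=> /injectiveP injL /eqP imL /forallP mono; split=> // [i|u v uv].
    by rewrite imL inE.
  by have /forallP/(_ v)/implyP := mono u; apply.
move=> injL imL mono; split; first exact/injectiveP.
  by apply/eqP/setP => i; rewrite inE imL.
by apply/forallP=> u; apply/forallP=> v; apply/implyP; apply: mono.
Qed.

Lemma linear_extension_rank L u : linear_extension L ->
  L u = (\sum_v (L v < L u)%N).+1 :> nat.
Proof.
case/linear_extensionP => injL imL _.
rewrite sum_bool_card -(card_imset _ injL).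
rewrite -{1}(card_ord_ltn (ltnW (ltn_ord (L u)))).
(* Every label below [L u] is attained except 0, which accounts for the successor in the
   statement. *)
have -> : [set i : 'I_#|X|.+1 | (i < L u)%N]
        = ord0 |: L @: [set v | (L v < L u)%N].
  apply/setP => i; rewrite !inE -val_eqE /=; case: (posnP i) => [->|i0] /=.
    by rewrite imL imset_f.
  have /imsetP[v _ ->] : i \in L @: X by rewrite -imL.
  by rewrite mem_imset // inE.
rewrite cardsU1; suff -> : ord0 \notin L @: [set v | (L v < L u)%N] by [].
apply/imsetP => -[v _ e]; suff : (0 < (ord0 : 'I_#|X|.+1))%N by [].
by rewrite imL e imset_f.
Qed.

Lemma linear_extension_lt_beta L : linear_extension L ->
  forall i j, (L (alpha i) < L (beta j))%N = ~~ (L (beta j) < L (alpha i))%N.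
Proof.
case/linear_extensionP => injL _ _ i j.
rewrite -leqNgt ltn_neqAle andb_idl // => _.
by rewrite val_eqE (inj_eq injL) alpha_neq_beta.
Qed.

Lemma linear_extension_mono L u v : linear_extension L ->
  (u <= v)%O -> (L u <= L v)%N.
Proof.
case/linear_extensionP => _ _ mono; rewrite le_eqVlt => /predU1P[-> //|/mono].
exact: ltnW.
Qed.

Lemma chain_le m (c : 'I_m -> X) : chain_enum c ->
  forall i j, (c i <= c j)%O = (i <= j)%N.
Proof.
move=> cc i j; rewrite le_eqVlt (inj_eq (chain_inj cc)) (chain_lt cc) -val_eqE.
by rewrite -leq_eqVlt.
Qed.

Lemma linear_extension_chain L m (c : 'I_m -> X) : linear_extension L ->
  chain_enum c -> forall i j, (L (c i) < L (c j))%N = (i < j)%N.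
Proof.
move=> lin cc i j; case: (ltnP i j) => le_ij.
  by case/linear_extensionP: lin => _ _; apply; rewrite chain_lt.
by apply/negbTE; rewrite -leqNgt linear_extension_mono // chain_le.
Qed.

(* In the lattice path picture, the height of the i-th horizontal step. *)
Definition heights L : heightfun :=
  [ffun i => inord #|[set j | (L (beta j) < L (alpha i))%N]|].

(** The label is the rank of [u] dictated by [h]: its position in its own chain, counted from 1,
    plus the number of elements of the other chain below it. The final 0 is never reached, since the
    chains cover [X]. *)
Definition label h (u : X) : nat :=
  if [pick i | alpha i == u] is Some i then (i.+1 + h i)%N
  else if [pick j | beta j == u] is Some j
       then (j.+1 + #|[set i | (h i <= j)%N]|)%N else 0%N.

Definition of_heights h : labelling := [ffun u => inord (label h u)].

(** At height [t], exactly the [beta j] with [j < t] precede [alpha i]; this must agree with every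
    relation between [alpha i] and the other chain. *)
Definition allowed (i : 'I_a) (t : nat) : bool :=
  [forall j : 'I_b, ((beta j < alpha i)%O ==> (j < t)%N)
                 && ((alpha i < beta j)%O ==> (t <= j)%N)].

Definition allowed_heights h : bool :=
  monotone h && [forall i, allowed i (h i)].

Lemma heightsE L i :
  heights L i = #|[set j | (L (beta j) < L (alpha i))%N]| :> nat.
Proof.
by rewrite ffunE inordK // ltnS -[X in (_ <= X)%N]card_ord max_card.
Qed.

Lemma ltn_heights L i (j : 'I_b) : linear_extension L ->
  (j < heights L i)%N = (L (beta j) < L (alpha i))%N.
Proof.
move=> lin; rewrite heightsE -card_downset ?inE // => j1 j2 le_j; rewrite !inE.
apply: leq_ltn_trans; apply: linear_extension_mono => //.
by case: hC => _ cb _ _; rewrite chain_le.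
Qed.

Lemma linear_extension_alpha L i : linear_extension L ->
  L (alpha i) = (i.+1 + heights L i)%N :> nat.
Proof.
move=> lin; case: (hC) => ca _ _ _; rewrite {1}linear_extension_rank //.
rewrite big_chains !sum_bool_card heightsE addSn; congr (_ + _).+1.
under eq_finset do rewrite linear_extension_chain //.
by rewrite card_ord_ltn // ltnW.
Qed.

Lemma linear_extension_beta L (j : 'I_b) : linear_extension L ->
  L (beta j) = (j.+1 + #|[set i | (heights L i <= j)%N]|)%N :> nat.
Proof.
move=> lin; case: (hC) => _ cb _ _; rewrite {1}linear_extension_rank //.
rewrite big_chains addnC !sum_bool_card addSn; congr (_ + _).+1.
  under eq_finset do rewrite linear_extension_chain //.
  by rewrite card_ord_ltn // ltnW.
apply: eq_card => i; rewrite !inE [(heights L i <= j)%N]leqNgt ltn_heights //.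
exact: linear_extension_lt_beta.
Qed.

Lemma label_alpha h i : label h (alpha i) = (i.+1 + h i)%N.
Proof.
case: (hC) => ca _ _ _; rewrite /label.
case: pickP => [i' /eqP /(chain_inj ca) -> //|].
by move/(_ i); rewrite eqxx.
Qed.

Lemma label_beta h (j : 'I_b) :
  label h (beta j) = (j.+1 + #|[set i | (h i <= j)%N]|)%N.
Proof.
case: (hC) => _ cb _ _; rewrite /label; case: pickP => [i e|_].
  by have := alpha_neq_beta i j; rewrite e.
case: pickP => [j' /eqP /(chain_inj cb) -> //|].
by move/(_ j); rewrite eqxx.
Qed.

Lemma of_heightsE h u : of_heights h u = label h u :> nat.
Proof.
rewrite ffunE inordK // ltnS card_chains.
case: (chainP u) => [i|j]; rewrite ?label_alpha ?label_beta.
  by rewrite leq_add // -ltnS.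
by rewrite addnC leq_add // -[X in (_ <= X)%N]card_ord max_card.
Qed.

Lemma heightsK L : linear_extension L -> of_heights (heights L) = L.
Proof.
move=> lin; apply/ffunP => u; apply: val_inj; rewrite /= of_heightsE.
case: (chainP u) => i; first by rewrite label_alpha linear_extension_alpha.
by rewrite label_beta linear_extension_beta.
Qed.

Lemma heights_allowed L : linear_extension L -> allowed_heights (heights L).
Proof.
move=> lin; apply/andP; split; apply/forallP => i; apply/forallP => j.
  apply/implyP=> le_ij; rewrite !heightsE; apply/subset_leq_card/subsetP => k.
  rewrite !inE => /leq_trans; apply; apply: linear_extension_mono => //.
  by case: hC => ca _ _ _; rewrite chain_le.
rewrite [(_ <= j)%N]leqNgt ltn_heights // -linear_extension_lt_beta //.
by case/linear_extensionP: lin => _ _ mono; apply/andP; split;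
  apply/implyP; apply: mono.
Qed.

(** For monotone [h] the indices with [h i <= j] form an initial segment, of size [c] say, so
    [h i <= j] iff [i < c]. Comparing [i.+1 + h i] with [j.+1 + c] then moves both summands the same
    way. *)
Lemma label_alpha_beta h i (j : 'I_b) : monotone h ->
  if (j < h i)%N then (label h (beta j) < label h (alpha i))%N
  else (label h (alpha i) < label h (beta j))%N.
Proof.
move=> /forallP mono; rewrite label_alpha label_beta.
have : (h i <= j)%N = (i < #|[set i | (h i <= j)%N]|)%N.
  rewrite -card_downset ?inE // => i1 i2 le_i; rewrite !inE; apply: leq_trans.
  by have /forallP/(_ i2)/implyP := mono i1; apply.
by move: #|_| => c; case: (ltnP j (h i)); lia.
Qed.

Lemma of_heights_linear h :
  allowed_heights h -> linear_extension (of_heights h).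
Proof.
case/andP=> mono /forallP allow; case: (hC) => ca cb _ _.
have lab u v : (u < v)%O -> (of_heights h u < of_heights h v)%N.
  rewrite !of_heightsE; case: (chainP u) => [i|j]; case: (chainP v) => [i'|j'].
  - rewrite (chain_lt ca) !label_alpha => lt_i.
    have /forallP/(_ i')/implyP := forallP mono i; lia.
  - have := label_alpha_beta i j' mono; case: ifP => // lt_j _ lt_ab.
    by have /forallP/(_ j')/andP[_ /implyP/(_ lt_ab)] := allow i; lia.
  - have := label_alpha_beta i' j mono; case: ifP => // lt_j _ lt_ba.
    by have /forallP/(_ j)/andP[/implyP/(_ lt_ba)] := allow i'; lia.
  - rewrite (chain_lt cb) !label_beta => lt_j.
    suff : (#|[set i | (h i <= j)%N]| <= #|[set i | (h i <= j')%N]|)%N by lia.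
    apply/subset_leq_card/subsetP => i; rewrite !inE; lia.
have label_neq i j : of_heights h (alpha i) != of_heights h (beta j) :> nat.
  by rewrite !of_heightsE neq_ltn; have := label_alpha_beta i j mono;
    case: ifP => _ ->; rewrite ?orbT.
have chain_of m (c : 'I_m -> X) i j : chain_enum c ->
    of_heights h (c i) = of_heights h (c j) -> c i = c j.
  move=> cc e; case: (ltngtP i j) => [/cc/lab|/cc/lab|/val_inj -> //];
  by rewrite e ltnn.
have inj : injective (of_heights h).
  move=> u v; case: (chainP u) => [i|j]; case: (chainP v) => [i'|j'] e.
  - exact: chain_of e.
  - by have := label_neq i j'; rewrite e eqxx.
  - by have := label_neq i' j; rewrite e eqxx.
  - exact: chain_of e.
apply/and3P; split; first exact/injectiveP.
  (* Injectivity gives as many labels as there are positive ones, so it suffices that every label is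
     positive. *)
  rewrite eqEcard card_labels card_imset // leqnn andbT.
  apply/subsetP => _ /imsetP[u _ ->]; rewrite inE of_heightsE.
  by case: (chainP u) => ?; rewrite ?label_alpha ?label_beta.
by apply/forallP=> u; apply/forallP=> v; apply/implyP; apply: lab.
Qed.

Lemma of_heightsK h : allowed_heights h -> heights (of_heights h) = h.
Proof.
case/andP=> mono _; apply/ffunP => i; apply: val_inj; rewrite /= heightsE.
have le_hb : (h i <= b)%N by rewrite -ltnS.
rewrite -[RHS](card_ord_ltn le_hb); apply: eq_card => j.
rewrite !inE !of_heightsE; have := label_alpha_beta i j mono.
by case: ifP => // _; apply: contraTF; rewrite -leqNgt; apply: ltnW.
Qed.

(** * The polynomials [Nq] as marginals *)

Lemma allowed_convex i s t u :
  allowed i s -> allowed i u -> (s <= t <= u)%N -> allowed i t.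
Proof.
move=> /forallP als /forallP alu stu; apply/forallP => j.
have /andP[/implyP s1 /implyP s2] := als j.
have /andP[/implyP u1 /implyP u2] := alu j.
by apply/andP; split; apply/implyP => lt_ab;
  [have := s1 lt_ab|have := u2 lt_ab]; lia.
Qed.

Definition height_weight (i : 'I_a) (t : nat) : {poly int} :=
  (allowed i t)%:R * 'X^t.

Lemma wgt_of_heights h :
  wgt alpha (of_heights h) = (\sum_(i < a) i.+1 + \sum_i h i)%N.
Proof.
rewrite /wgt -big_split; apply: eq_bigr => i _.
by rewrite of_heightsE label_alpha.
Qed.

Lemma Nq_marginal r (t : nat) :
  Nq alpha (alpha r) (r.+1 + t)%N =
  'X^(\sum_(i < a) i.+1) * marginal b.+1 height_weight r t.
Proof.
rewrite /Nq (reindex_onto of_heights heights) => [|L /andP[lin _]];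
  last exact: heightsK.
rewrite /marginal /monotone_sum mulr_sumr big_mkcond [RHS]big_mkcond /=.
apply: eq_bigr => h _; rewrite of_heightsE label_alpha eqz_nat eqn_add2l.
have -> : linear_extension (of_heights h) && (h r == t :> nat)
      && (heights (of_heights h) == h) = allowed_heights h && (h r == t :> nat).
  apply/andP/andP => [[/andP[lin ->] /eqP <-]|[alh ->]].
    by rewrite heights_allowed.
  by rewrite of_heights_linear // of_heightsK.
have -> : [forall i, (0 <= h i)%N] by apply/forallP.
rewrite /allowed_heights andbT; case: (monotone h) => //=.
case: andP => [[/forallP alh /eqP hr]|no].
  rewrite wgt_of_heights exprD -prodrXr; congr (_ * _); apply: eq_bigr => i _.
  rewrite /height_weight alh mul1r.
  by case: eqP => [->|_]; rewrite ?hr ?eqxx mulr1.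
(* If [h] is excluded on the left, some factor on the right vanishes: the one at [r] if [h r]
   differs from [t], otherwise one at a forbidden height. *)
apply/esym/eqP; rewrite mulf_eq0; apply/orP; right.
case: (boolP [forall i, allowed i (h i)]) no => [_ no|].
  rewrite (bigD1 r) //= eqxx /=; case: eqP no => [_ []//|_ _].
  by rewrite mulr0 mul0r.
rewrite negb_forall => /existsP[i /negPf nal] _.
by rewrite (bigD1 i) //= /height_weight nal !mul0r.
Qed.

Lemma Nq_alpha_log_concave r (k : int) :
  Nq alpha (alpha r) k ^+ 2
    - Nq alpha (alpha r) (k - 1) * Nq alpha (alpha r) (k + 1)
    \in nneg_poly.
Proof.
(* The label of [alpha r] is at least [r.+1], so below that bound the subtracted product is 0.
   Otherwise [k - 1], [k], [k + 1] correspond to heights [t], [t + 1], [t + 2]. *)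
have [le_k|lt_k] := leP (r.+1%:Z) (k - 1); last first.
  have -> : Nq alpha (alpha r) (k - 1) = 0.
    rewrite /Nq big1 // => L /andP[lin /eqP Lr].
    by have := linear_extension_alpha r lin; lia.
  rewrite mul0r subr0; apply: rpredX; apply: rpred_sum => L _.
  exact/rpredX/nneg_polyX.
have [t ->] : exists t : nat, k = (r.+1 + t.+1)%N
  by exists `|k - r.+1%:Z|.-1; lia.
have -> : ((r.+1 + t.+1)%N : int) - 1 = (r.+1 + t)%N by lia.
have -> : ((r.+1 + t.+1)%N : int) + 1 = (r.+1 + t.+2)%N by lia.
rewrite !Nq_marginal; set c := 'X^_; set F := marginal _ _ _.
have -> : (c * F t.+1) ^+ 2 - c * F t * (c * F t.+2)
        = c ^+ 2 * (F (t + 1)%N * F (t + 1)%N - F t * F (t + 1 + 1)%N).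
  by rewrite !addn1; ring.
suff [_ lcF] : log_concave nneg_poly F by rewrite rpredM ?rpredX ?nneg_polyX.
apply: log_concave_marginal => i.
apply: log_concaveM; last exact/log_concave_exp/nneg_polyX.
by apply: log_concave_indicator => ? ? ?; apply: allowed_convex.
Qed.

(** Together the two chains carry each positive label exactly once. *)
Lemma wgt_complement L : linear_extension L ->
  (wgt alpha L + wgt beta L = \sum_(i : 'I_#|X|.+1 | 0 < i) i)%N.
Proof.
case/linear_extensionP => injL imL _.
rewrite /wgt -(big_chains (fun u => L u)) (eq_bigl _ _ imL).
by rewrite (big_imset _ (in2W injL)).
Qed.

End TwoChains.

(** * Exchanging the two chains *)

Lemma chain_partition_sym (d : Order.disp_t) (X : finPOrderType d) (a b : nat)
    (alpha : 'I_a -> X) (beta : 'I_b -> X) :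
  chain_partition alpha beta -> chain_partition beta alpha.
Proof. by case=> ca cb dis full; split; rewrite // 1?disjoint_sym // setUC. Qed.

Lemma coef_NqM (d : Order.disp_t) (X : finPOrderType d) (a : nat)
    (alpha : 'I_a -> X) (x : X) (k l : int) (m : nat) :
  (Nq alpha x k * Nq alpha x l)`_m =
  \sum_(L : {ffun X -> 'I_#|X|.+1} | linear_extension L && ((L x)%:Z == k))
  \sum_(L' : {ffun X -> 'I_#|X|.+1} | linear_extension L' && ((L' x)%:Z == l))
     (m == wgt alpha L + wgt alpha L')%N%:R.
Proof.
rewrite mulr_suml coef_sum; apply: eq_bigr => L _.
rewrite mulr_sumr coef_sum; apply: eq_bigr => L' _.
by rewrite -exprD coefXn.
Qed.

Theorem theorem1p3 (d : Order.disp_t) (X : finPOrderType d) (hw : width X = 2%N)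
    (a b : nat) (alpha : 'I_a -> X) (beta : 'I_b -> X)
    (hC : chain_partition alpha beta) (x : X) (k : int) (hk : 1 < k) (m : nat) :
  0 <= (Nq alpha x k ^+ 2 - Nq alpha x (k - 1) * Nq alpha x (k + 1))`_m.
Proof.
case: (chainP hC x) => r.
  by have /nneg_polyP := Nq_alpha_log_concave hC r k; apply.
pose M := (\sum_(i : 'I_#|X|.+1 | 0 < i) i)%N.
(* Pairs of extensions of total [alpha]-weight [m] are those of total [beta]-weight [M + M - m]. The
   guard is there because subtraction on [nat] truncates; no pair has weight above [M + M]. *)
have reverse l l' : (Nq alpha (beta r) l * Nq alpha (beta r) l')`_m
    = if (m <= M + M)%N
      then (Nq beta (beta r) l * Nq beta (beta r) l')`_(M + M - m)
      else 0.
  rewrite !coef_NqM; case: leqP => le_m;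
    [apply: eq_bigr|apply: big1] => L /andP[lin _];
    [apply: eq_bigr|apply: big1] => L' /andP[lin' _];
    have := wgt_complement hC lin; have := wgt_complement hC lin';
    rewrite -/M => e e'.
    by congr (nat_of_bool _)%:R; apply/eqP/eqP; lia.
  by rewrite (_ : (m == _) = false) //; apply/eqP; lia.
rewrite expr2 coefB !reverse; case: ifP => _; last by rewrite subrr.
rewrite -coefB -expr2.
by have /nneg_polyP :=
  Nq_alpha_log_concave (chain_partition_sym hC) r k; apply.
Qed.
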